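(* Let $k$ be an algebraically closed field of characteristic $p>0$ and let $X\subset\mathbb P^3_k$ be a smooth extremal surface. The automorphism group $\operatorname{Aut}(X)$ acts transitively on the set of ordered triples $(L_1,L_2,L_3)$ of pairwise skew lines on $X$.
   Context: $k$ is an algebraically closed field of characteristic $p>0$. A Frobenius form is a homogeneous polynomial of degree $q+1$, where $q=p^e$ for some $e\ge 1$, of the form $\sum_i x_i^{q}L_i$ with each $L_i$ a linear form. An extremal surface of degree $q+1$ is a surface in $\mathbb P^3_k$ defined by a Frobenius form of degree $q+1$ in four variables. Automorphisms are projective linear: $\operatorname{Aut}(X)$ is the subgroup of $\operatorname{PGL}(4,k)$ preserving $X$. *)

(* Defs.v *)
From HB Require Import structures.
From mathcomp Require Import all_boot all_order all_algebra.
From mathcomp Require Import mpoly.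

Set Implicit Arguments.
Unset Strict Implicit.
Unset Printing Implicit Defensive.

Import GRing.Theory.
Local Open Scope ring_scope.
Local Open Scope quotient_scope.

Record GL (k : fieldType) (n : nat) : Type :=
  MkGL { GLmx : 'M[k]_n; GLmx_unit : GLmx \in unitmx }.
HB.instance Definition _ (k : fieldType) (n : nat) :=
  [isSub for @GLmx k n].
HB.instance Definition _ (k : fieldType) (n : nat) :=
  [Choice of GL k n by <:].

Lemma GL_mul_unit (k : fieldType) (n : nat) (A B : GL k n) :
  GLmx A *m GLmx B \in unitmx.
Proof. by rewrite unitmx_mul !GLmx_unit. Qed.

Lemma GL_inv_unit (k : fieldType) (n : nat) (A : GL k n) :
  invmx (GLmx A) \in unitmx.
Proof. by rewrite unitmx_inv GLmx_unit. Qed.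

Definition GL_mul (k : fieldType) (n : nat) (A B : GL k n) : GL k n :=
  MkGL (GL_mul_unit A B).
Definition GL_one (k : fieldType) (n : nat) : GL k n :=
  MkGL (unitmx1 k n).
Definition GL_inv (k : fieldType) (n : nat) (A : GL k n) : GL k n :=
  MkGL (GL_inv_unit A).

Lemma GL_mulA (k : fieldType) (n : nat) : associative (@GL_mul k n).
Proof. by move=> A B C; apply: val_inj; rewrite /= mulmxA. Qed.
Lemma GL_mul1 (k : fieldType) (n : nat) : left_id (GL_one k n) (@GL_mul k n).
Proof. by move=> A; apply: val_inj; rewrite /= mul1mx. Qed.
Lemma GL_1mul (k : fieldType) (n : nat) : right_id (GL_one k n) (@GL_mul k n).
Proof. by move=> A; apply: val_inj; rewrite /= mulmx1. Qed.
Lemma GL_mulV (k : fieldType) (n : nat) :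
  left_inverse (GL_one k n) (@GL_inv k n) (@GL_mul k n).
Proof. by move=> A; apply: val_inj; rewrite /= mulVmx ?GLmx_unit. Qed.
Lemma GL_Vmul (k : fieldType) (n : nat) :
  right_inverse (GL_one k n) (@GL_inv k n) (@GL_mul k n).
Proof. by move=> A; apply: val_inj; rewrite /= mulmxV ?GLmx_unit. Qed.

HB.instance Definition _ (k : fieldType) (n : nat) :=
  isGroup.Build (GL k n) (@GL_mulA k n) (@GL_mul1 k n) (@GL_1mul k n)
    (@GL_mulV k n) (@GL_Vmul k n).

(* Two matrices are proportional when, read as vectors, they span the same    *)
(* line; see [proportionalP].                                                 *)
Definition proportional (k : fieldType) (n : nat) (A B : GL k n) : bool :=
  (mxvec (GLmx A) == mxvec (GLmx B))%MS.

Lemma proportionalP (k : fieldType) (n : nat) (A B : GL k n) :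
  reflect (exists2 c : k, c != 0 & GLmx A = c *: GLmx B) (proportional A B).
Proof.
apply: (iffP idP) => [|[c c0 eAB]]; last first.
  apply/eqmxP; rewrite eAB linearZ; exact: eqmx_scale.
case/andP => /sub_rVP[c /esym ec] /sub_rVP[d /esym ed].
have eA : GLmx A = c *: GLmx B.
  by apply: (can_inj mxvecK); rewrite -ec linearZ.
have [c0|c0] := eqVneq c 0; last by exists c.
have A0 : GLmx A = 0 by rewrite eA c0 scale0r.
have B0 : GLmx B = 0.
  by apply: (can_inj mxvecK); rewrite -ed A0 !linear0.
by exists 1; rewrite ?oner_neq0 // A0 B0 scaler0.
Qed.

Lemma proportional_refl (k : fieldType) (n : nat) :
  reflexive (@proportional k n).
Proof. by move=> A; apply/eqmxP. Qed.
Lemma proportional_sym (k : fieldType) (n : nat) :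
  ssrbool.symmetric (@proportional k n).
Proof. by move=> A B; rewrite /proportional andbC. Qed.
Lemma proportional_trans (k : fieldType) (n : nat) :
  transitive (@proportional k n).
Proof.
move=> B A C /eqmxP eAB /eqmxP eBC; apply/eqmxP.
exact: eqmx_trans eAB eBC.
Qed.

Canonical proportional_equiv (k : fieldType) (n : nat) :=
  EquivRel (@proportional k n) (@proportional_refl k n)
    (@proportional_sym k n) (@proportional_trans k n).

Definition PGL (k : fieldType) (n : nat) : Type :=
  {eq_quot proportional_equiv k n}.
HB.instance Definition _ (k : fieldType) (n : nat) := Choice.on (PGL k n).
HB.instance Definition _ (k : fieldType) (n : nat) :=
  EqQuotient.on (PGL k n).

Definition PGL_mk (k : fieldType) (n : nat) (A : GL k n) : PGL k n :=
  \pi_(PGL k n) A.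

Lemma PGL_mkP (k : fieldType) (n : nat) (A B : GL k n) :
  PGL_mk A = PGL_mk B <-> exists2 c : k, c != 0 & GLmx A = c *: GLmx B.
Proof.
by split=> [/eqmodP/proportionalP|/proportionalP h] //; apply/eqmodP.
Qed.

Lemma PGL_reprK (k : fieldType) (n : nat) (g : PGL k n) : PGL_mk (repr g) = g.
Proof. exact: reprK. Qed.

Lemma repr_PGL (k : fieldType) (n : nat) (A : GL k n) :
  exists2 c : k, c != 0 & GLmx (repr (PGL_mk A)) = c *: GLmx A.
Proof. by apply/PGL_mkP; rewrite PGL_reprK. Qed.

Definition PGL_mul (k : fieldType) (n : nat) (g h : PGL k n) : PGL k n :=
  PGL_mk (repr g * repr h)%g.
Definition PGL_one (k : fieldType) (n : nat) : PGL k n := PGL_mk 1%g.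
Definition PGL_inv (k : fieldType) (n : nat) (g : PGL k n) : PGL k n :=
  PGL_mk ((repr g)^-1)%g.

Lemma PGL_mkM (k : fieldType) (n : nat) (A B : GL k n) :
  PGL_mk (A * B)%g = PGL_mul (PGL_mk A) (PGL_mk B).
Proof.
have [a a0 ea] := repr_PGL A; have [b b0 eb] := repr_PGL B.
apply/esym/PGL_mkP; exists (a * b); first by rewrite mulf_neq0.
by rewrite /= ea eb -scalemxAl -scalemxAr scalerA.
Qed.

Lemma PGL_mulA (k : fieldType) (n : nat) : associative (@PGL_mul k n).
Proof.
move=> f g h; rewrite -(PGL_reprK f) -(PGL_reprK g) -(PGL_reprK h).
by rewrite -!PGL_mkM mulgA.
Qed.
Lemma PGL_mul1 (k : fieldType) (n : nat) : left_id (PGL_one k n) (@PGL_mul k n).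
Proof. by move=> g; rewrite -(PGL_reprK g) -PGL_mkM mul1g. Qed.
Lemma PGL_1mul (k : fieldType) (n : nat) :
  right_id (PGL_one k n) (@PGL_mul k n).
Proof. by move=> g; rewrite -(PGL_reprK g) -PGL_mkM mulg1. Qed.
Lemma PGL_mulV (k : fieldType) (n : nat) :
  left_inverse (PGL_one k n) (@PGL_inv k n) (@PGL_mul k n).
Proof. by move=> g; rewrite -{2}(PGL_reprK g) -PGL_mkM mulVg. Qed.
Lemma PGL_Vmul (k : fieldType) (n : nat) :
  right_inverse (PGL_one k n) (@PGL_inv k n) (@PGL_mul k n).
Proof. by move=> g; rewrite -{1}(PGL_reprK g) -PGL_mkM mulgV. Qed.

HB.instance Definition _ (k : fieldType) (n : nat) :=
  isGroup.Build (PGL k n) (@PGL_mulA k n) (@PGL_mul1 k n) (@PGL_1mul k n)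
    (@PGL_mulV k n) (@PGL_Vmul k n).

(* Linear subspaces of the projective space P(k^n) are encoded as vector      *)
(* subspaces of k^n, of dimension one higher: points are the subspaces of     *)
(* dimension 1 and lines those of dimension 2.                                *)
Definition is_point (k : fieldType) (n : nat) (P : {vspace 'cV[k]_n}) : Prop :=
  \dim P = 1%N.
Definition is_line (k : fieldType) (n : nat) (L : {vspace 'cV[k]_n}) : Prop :=
  \dim L = 2%N.

Definition PGL_act (k : fieldType) (n : nat) (g : PGL k n)
    (U : {vspace 'cV[k]_n}) : {vspace 'cV[k]_n} :=
  (linfun (mulmx (GLmx (repr g))) @: U)%VS.

Lemma PGL_act_mk (k : fieldType) (n : nat) (A : GL k n)
    (U : {vspace 'cV[k]_n}) :
  PGL_act (PGL_mk A) U = (linfun (mulmx (GLmx A)) @: U)%VS.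
Proof.
have [c c0 ec] := repr_PGL A; apply/vspaceP => v.
apply/memv_imgP/memv_imgP => -[u uU ->].
  exists (c *: u); first by rewrite memvZ.
  by rewrite !lfunE /= ec -scalemxAl -scalemxAr.
exists (c^-1 *: u); first by rewrite memvZ.
by rewrite !lfunE /= ec -scalemxAl -scalemxAr scalerA divff ?scale1r.
Qed.

Lemma PGL_act1 (k : fieldType) (n : nat) (U : {vspace 'cV[k]_n}) :
  PGL_act 1%g U = U.
Proof.
rewrite [1%g]/(PGL_mk _) PGL_act_mk -[RHS]lim1g; apply: eq_in_limg => v _.
by rewrite !lfunE /= mul1mx.
Qed.

Lemma PGL_actM (k : fieldType) (n : nat) (g h : PGL k n)
    (U : {vspace 'cV[k]_n}) :
  PGL_act (g * h)%g U = PGL_act g (PGL_act h U).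
Proof.
rewrite -(PGL_reprK g) -(PGL_reprK h) -[(_ * _)%g]PGL_mkM !PGL_act_mk.
rewrite -limg_comp; apply: eq_in_limg => v _.
by rewrite !lfunE /= !lfunE /= mulmxA.
Qed.

Lemma dim_PGL_act (k : fieldType) (n : nat) (g : PGL k n)
    (U : {vspace 'cV[k]_n}) : \dim (PGL_act g U) = \dim U.
Proof.
apply: limg_dim_eq; apply/eqP; rewrite -subv0; apply/subvP => v.
rewrite memv_cap memv_ker memv0 lfunE /= => /andP[_ /eqP e].
by rewrite -(mulKmx (GLmx_unit (repr g)) v) e mulmx0.
Qed.

Definition mpeval (k : fieldType) (n : nat) (f : {mpoly k[n]}) (v : 'cV[k]_n) :
  k := f.@[fun i => v i 0].

Definition point_of (k : fieldType) (n : nat) (f : {mpoly k[n]})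
    (P : {vspace 'cV[k]_n}) : Prop :=
  is_point P /\ forall v, v \in P -> mpeval f v = 0.

Definition line_of (k : fieldType) (n : nat) (f : {mpoly k[n]})
    (L : {vspace 'cV[k]_n}) : Prop :=
  is_line L /\
  forall P : {vspace 'cV[k]_n}, is_point P -> (P <= L)%VS -> point_of f P.

Definition frobenius_form (k : fieldType) (n q : nat) (f : {mpoly k[n]}) :
    Prop :=
  exists L : 'I_n -> {mpoly k[n]},
    (forall i, L i \is 1.-homog) /\ f = \sum_(i < n) 'X_i ^+ q * L i.

(* Projective Jacobian criterion: smoothness of the closed subscheme of       *)
(* P(k^n) defined by the form f, for k algebraically closed.                  *)
Definition smooth_form (k : fieldType) (n : nat) (f : {mpoly k[n]}) : Prop :=
  forall v : 'cV[k]_n, v != 0 -> mpeval f v = 0 ->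
    exists i : 'I_n, mpeval f^`M(i) v != 0.

(* When f is smooth, its zero scheme is reduced, so preserving it amounts to   *)
(* preserving its set of closed points.                                       *)
Definition in_Aut (k : fieldType) (n : nat) (f : {mpoly k[n]}) (g : PGL k n) :
    Prop :=
  forall P : {vspace 'cV[k]_n}, is_point P ->
    (point_of f (PGL_act g P) <-> point_of f P).

Lemma in_Aut1 (k : fieldType) (n : nat) (f : {mpoly k[n]}) : in_Aut f 1%g.
Proof. by move=> P _; rewrite PGL_act1. Qed.

Lemma in_AutM (k : fieldType) (n : nat) (f : {mpoly k[n]}) (g h : PGL k n) :
  in_Aut f g -> in_Aut f h -> in_Aut f (g * h)%g.
Proof.
move=> fg fh P ptP; rewrite PGL_actM -(fh _ ptP); apply: fg.
by rewrite /is_point dim_PGL_act.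
Qed.

Lemma in_AutV (k : fieldType) (n : nat) (f : {mpoly k[n]}) (g : PGL k n) :
  in_Aut f g -> in_Aut f (g^-1)%g.
Proof.
move=> fg P ptP; rewrite -fg; last by rewrite /is_point dim_PGL_act.
by rewrite -PGL_actM mulgV PGL_act1.
Qed.

Definition skew (k : fieldType) (n : nat) (L M : {vspace 'cV[k]_n}) : Prop :=
  (L :&: M)%VS = 0%VS.

Definition triple (T : Type) : Type := (T * T * T)%type.

Definition skew_triple_of (k : fieldType) (n : nat) (f : {mpoly k[n]})
    (t : triple {vspace 'cV[k]_n}) : Prop :=
  let: (L1, L2, L3) := t in
  [/\ line_of f L1, line_of f L2 & line_of f L3] /\
  [/\ skew L1 L2, skew L1 L3 & skew L2 L3].

Definition triple_act (k : fieldType) (n : nat) (g : PGL k n)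
    (t : triple {vspace 'cV[k]_n}) : triple {vspace 'cV[k]_n} :=
  let: (L1, L2, L3) := t in (PGL_act g L1, PGL_act g L2, PGL_act g L3).

(* The subgroup H of G acts on the subset S of T, transitively.               *)
Definition acts_transitively_on (G T : Type) (act : G -> T -> T)
    (H : G -> Prop) (S : T -> Prop) : Prop :=
  (forall g x, H g -> S x -> S (act g x)) /\
  (forall x y, S x -> S y -> exists2 g, H g & act g x = y).

(* Main.v *)
(* Writing the Frobenius form as F(v) = B(v, v) with B(x, y) = s(x)^T A y and *)
(* s the q-th power map, smoothness means that A is invertible, and a line    *)
(* lies on the surface iff it is totally isotropic for B.  A triple of        *)
(* pairwise skew lines on the surface determines, up to a choice of basis of  *)
(* the first line, a frame of k^4 in which the lines are <e1, e2>, <e3, e4>   *)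
(* and <e1 + e3, e2 + e4>; there A becomes [[0, C], [-C, 0]].  The remaining  *)
(* choice puts C in a normal form that does not depend on the triple, so the  *)
(* matrix taking the frame of one triple to that of another preserves F.      *)

Require Import Defs.
From mathcomp Require Import all_boot all_order all_algebra.
From mathcomp Require Import mpoly ring.

Set Implicit Arguments.
Unset Strict Implicit.
Unset Printing Implicit Defensive.

Import GRing.Theory.
Local Open Scope ring_scope.

(** That automorphisms preserve skew triples on the surface is formal ([skew_triple_PGL_act]);
    transitivity compares Gram matrices of [B]. Smoothness makes [A] invertible
    ([smooth_frobenius_unit]), and vanishing on a line gives total isotropy ([sesqui_alternating]).
    Over an algebraically closed field every invertible 2 x 2 block is equivalent to one fixed
    matrix ([sesqui_hyperbolic]), so every triple has a frame with the same Gram matrix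
    ([adapted_frame]). The matrix taking one such frame to another is then an isometry of [B]
    ([sesqui_eq]). *)

Lemma unitmx_inj {k : fieldType} {n : nat} (M : 'M[k]_n) :
  (forall x : 'cV_n, M *m x = 0 -> x = 0) -> M \in unitmx.
Proof.
move=> injM; rewrite unitmxE unitfE -det_tr; apply/negP => /det0P[u u0 uM].
case/eqP: u0; apply: trmx_inj; rewrite trmx0; apply: injM.
by rewrite -[M]trmxK -trmx_mul uM trmx0.
Qed.

Lemma closed_root (k : closedFieldType) (p : {poly k}) n :
  (0 < n)%N -> p`_n != 0 -> exists x, p.[x] = 0.
Proof.
move=> n0 pn; have /closed_rootP[x /rootP] : size p != 1%N; last by exists x.
by apply: contraNneq pn => sp; rewrite nth_default // sp.
Qed.

(** * Subspaces as column spans *)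

Section ColumnSpan.
Variables (k : fieldType) (m : nat).
Implicit Type L : {vspace 'cV[k]_m}.

Definition colspan {n} (M : 'M[k]_(m, n)) : {vspace 'cV[k]_m} :=
  limg (linfun (mulmx M)).

Lemma memv_colspan {n} (M : 'M[k]_(m, n)) v :
  v \in colspan M <-> exists x, v = M *m x.
Proof.
split=> [/memv_imgP[x _ ->]|[x ->]]; first by exists x; rewrite lfunE.
by apply/memv_imgP; exists x; rewrite ?memvf // lfunE.
Qed.

Lemma colspan_mulmx {n} (M : 'M[k]_(m, n)) R :
  R \in unitmx -> colspan (M *m R) = colspan M.
Proof.
move=> uR; apply/vspaceP => v; apply/idP/idP => /memv_colspan[x ->].
  by apply/memv_colspan; exists (R *m x); rewrite mulmxA.
by apply/memv_colspan; exists (invmx R *m x); rewrite -mulmxA mulKVmx.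
Qed.

Lemma PGL_act_colspan {n} (A : GL k m) (M : 'M[k]_(m, n)) :
  PGL_act (PGL_mk A) (colspan M) = colspan (GLmx A *m M).
Proof.
rewrite PGL_act_mk -limg_comp; apply: eq_in_limg => v _.
by rewrite !lfunE /= !lfunE /= mulmxA.
Qed.

Lemma colspan_basis {n : nat} L : \dim L = n ->
  exists2 M : 'M[k]_(m, n),
    colspan M = L & forall x : 'cV_n, M *m x = 0 -> x = 0.
Proof.
move=> <-; pose M := \matrix_(i < m, j < \dim L) (vbasis L)`_j i 0.
have ME (x : 'cV_(\dim L)) : M *m x = \sum_j x j 0 *: (vbasis L)`_j.
  apply/colP => i; rewrite mxE summxE; apply: eq_bigr => j _.
  by rewrite !mxE mulrC.
exists M => [|x].
  apply/vspaceP => v; apply/idP/idP => [/memv_colspan[x ->]|vL].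
    rewrite ME; apply: memv_suml => j _; apply/memvZ/vbasis_mem.
    by rewrite mem_nth // size_tuple.
  apply/memv_colspan; exists (\col_j coord (vbasis L) j v).
  by rewrite ME [LHS](coord_vbasis vL); apply: eq_bigr => j _; rewrite mxE.
rewrite ME; move/freeP: (basis_free (vbasisP L)) => /(_ (fun j => x j 0)) h.
by move=> /h x0; apply/colP => j; rewrite x0 mxE.
Qed.

End ColumnSpan.

Lemma row_mx_unit (k : fieldType) n n' (U : 'M[k]_(n + n', n))
    (W : 'M_(n + n', n')) :
    (forall x : 'cV_n, U *m x = 0 -> x = 0) ->
    (forall x : 'cV_n', W *m x = 0 -> x = 0) ->
  Defs.skew (colspan U) (colspan W) -> row_mx U W \in unitmx.
Proof.
move=> U0 W0 skUW; apply: unitmx_inj => x.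
rewrite -[x]vsubmxK mul_row_col; set a := usubmx x; set b := dsubmx x => ab.
have Ua : U *m a = 0.
  apply/eqP; rewrite -memv0 -[0%VS]skUW memv_cap; apply/andP; split.
    by apply/memv_colspan; exists a.
  apply/memv_colspan; exists (- b); rewrite mulmxN; apply/eqP.
  by rewrite -addr_eq0 ab.
move: ab; rewrite Ua add0r => /W0 ->; rewrite (U0 _ Ua).
exact: col_mx0.
Qed.

(** * Sesquilinear forms and their normal form in dimension 2 *)

Section SesquilinearForms.
Variables (k : closedFieldType) (s : {rmorphism k -> k}).

(* The matrix of values, on the columns of [U] and [W], of the form           *)
(* (x, y) |-> s(x)^T A y, semilinear in x and linear in y.                    *)
Definition sesqui {m m' n n'} (A : 'M[k]_(m, m')) (U : 'M_(m, n))
  (W : 'M_(m', n')) : 'M_(n, n') := (map_mx s U)^T *m A *m W.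

Lemma sesqui_mulmx {m m' n n' l l'} (A : 'M[k]_(m, m')) (U : 'M_(m, n))
    (W : 'M_(m', n')) (P : 'M_(n, l)) (Q : 'M_(n', l')) :
  sesqui A (U *m P) (W *m Q) = sesqui (sesqui A U W) P Q.
Proof. by rewrite /sesqui map_mxM trmx_mul !mulmxA. Qed.

Lemma sesquiDl {m m' n n'} (A : 'M[k]_(m, m')) (U V : 'M_(m, n))
    (W : 'M_(m', n')) : sesqui A (U + V) W = sesqui A U W + sesqui A V W.
Proof. by rewrite /sesqui map_mxD linearD /= !mulmxDl. Qed.

Lemma sesquiDr {m m' n n'} (A : 'M[k]_(m, m')) (U : 'M_(m, n))
    (V W : 'M_(m', n')) : sesqui A U (V + W) = sesqui A U V + sesqui A U W.
Proof. exact: mulmxDr. Qed.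

Lemma sesquiZl {m m' n n'} (A : 'M[k]_(m, m')) c (U : 'M_(m, n))
    (W : 'M_(m', n')) : sesqui A (c *: U) W = s c *: sesqui A U W.
Proof. by rewrite /sesqui map_mxZ linearZ /= -!scalemxAl. Qed.

Lemma sesquiZr {m m' n n'} (A : 'M[k]_(m, m')) c (U : 'M_(m, n))
    (W : 'M_(m', n')) : sesqui A U (c *: W) = c *: sesqui A U W.
Proof. by rewrite /sesqui -scalemxAr. Qed.

Lemma sesquiN {m m' n n'} (A : 'M[k]_(m, m')) (U : 'M_(m, n))
    (W : 'M_(m', n')) : sesqui (- A) U W = - sesqui A U W.
Proof. by rewrite /sesqui mulmxN mulNmx. Qed.

Lemma sesqui0 {m m' n n'} (U : 'M_(m, n)) (W : 'M_(m', n')) :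
  sesqui 0 U W = 0.
Proof. by rewrite /sesqui mulmx0 mul0mx. Qed.

Lemma sesqui_row {m n n'} (A : 'M[k]_m) (U : 'M_(m, n)) (W : 'M_(m, n')) :
  sesqui A (row_mx U W) (row_mx U W) =
  block_mx (sesqui A U U) (sesqui A U W) (sesqui A W U) (sesqui A W W).
Proof.
by rewrite /sesqui map_row_mx tr_row_mx mul_col_mx mul_col_row.
Qed.

Lemma sesqui_unitmx {n} (A G : 'M[k]_n) :
  (sesqui A G G \in unitmx) = (A \in unitmx) && (G \in unitmx).
Proof.
by rewrite /sesqui !unitmx_mul unitmx_tr map_unitmx andbAC andbb andbC.
Qed.

Lemma sesqui_eq {n} (A G G' : 'M[k]_n) :
  G \in unitmx -> sesqui A G G = sesqui A G' G' ->
  sesqui A (G' *m invmx G) (G' *m invmx G) = A.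
Proof.
move=> uG eG; rewrite sesqui_mulmx -eG -sesqui_mulmx mulmxV //.
by rewrite /sesqui map_mx1 trmx1 mul1mx mulmx1.
Qed.

Variables (q : nat) (q_gt1 : (1 < q)%N) (sE : forall x, s x = x ^+ q).

(** Polarising gives N(y, x) = -N(x, y); replacing y by b y scales one side by b^q and the other by
    b, so any b with b^q != b forces N(x, y) = 0. *)
Lemma sesqui_alternating {n} (N : 'M[k]_n) :
  (forall x : 'cV_n, sesqui N x x = 0) -> N = 0.
Proof.
move=> N0; have [b] : exists b, ~~ root ('X^q - 'X : {poly k}) b.
  apply/closed_nonrootP/eqP => /polyP/(_ q).
  by rewrite !coefE eqxx gtn_eqF // subr0 => /eqP; rewrite oner_eq0.
rewrite /root !hornerE subr_eq0 => b_q.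
have N2 (x y : 'cV_n) : sesqui N x y = 0.
  have yx : sesqui N y x = - sesqui N x y.
    apply/eqP; rewrite -addr_eq0 addrC; have := N0 (x + y).
    by rewrite sesquiDl !sesquiDr !N0 add0r addr0 => ->.
  have := N0 (x + b *: y); rewrite sesquiDl !sesquiDr !sesquiZl !sesquiZr !N0.
  rewrite yx !scaler0 add0r addr0 scalerN -scalerBl => /eqP.
  by rewrite scaler_eq0 subr_eq0 sE eq_sym (negPf b_q) => /eqP.
apply/matrixP => i j; have /matrixP/(_ 0 0) := N2 (delta_mx i 0) (delta_mx j 0).
by rewrite /sesqui map_delta_mx trmx_delta -rowE -colE !mxE.
Qed.

(** The Gram matrix of x^q y + y^q x. *)
Definition hyperbolic : 'M[k]_(1 + 1) :=
  block_mx (0 : 'M_1) 1%:M 1%:M (0 : 'M_1).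

Lemma hyperbolic_unit : hyperbolic \in unitmx.
Proof.
suff /mulmx1_unit[] : hyperbolic *m hyperbolic = 1%:M by [].
rewrite /hyperbolic mulmx_block !mul0mx !mulmx0 !mul1mx !add0r !addr0.
by rewrite -scalar_mx_block.
Qed.

(* A root [v] of the form exists, and any [w0] with [sesqui C v w0 = 1] can   *)
(* be corrected by a multiple of [v] to another root.  This makes the matrix  *)
(* antidiagonal, and it remains to rescale.                                   *)
Lemma sesqui_hyperbolic (C : 'M[k]_2) : C \in unitmx ->
  exists2 P : 'M_2, P \in unitmx & sesqui C P P = hyperbolic.
Proof.
move=> uC; have q0 : (0 < q)%N by apply: ltnW.
have [v v0 vv] : exists2 v : 'cV_2, v != 0 & sesqui C v v = 0.
  have CE (x : 'cV_2) : sesqui C x x 0 0 = s (x 0 0) * C 0 0 * x 0 0 +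
      s (x 1 0) * C 1 0 * x 0 0 +
      (s (x 0 0) * C 0 1 + s (x 1 0) * C 1 1) * x 1 0.
    have l1 : lift 0 0 = 1 :> 'I_2 by apply/val_inj.
    rewrite /sesqui !mxE !big_ord_recl big_ord0 !mxE !big_ord_recl !big_ord0.
    by rewrite !mxE !l1 !addr0 mulrDl.
  have [C0|C0] := eqVneq (C 0 0) 0.
    exists (delta_mx 0 0).
      by apply/eqP => /colP/(_ 0)/eqP; rewrite !mxE oner_eq0.
    apply/rowP => i; rewrite !ord1 CE !mxE /= C0 rmorph0 rmorph1.
    by rewrite !(mul0r, mulr0, addr0).
  (* The form at (z, 1), of degree q + 1 in z since [C 0 0] is nonzero. *)
  pose p : {poly k} :=
    C 0 0 *: 'X^(q.+1) + C 0 1 *: 'X^q + C 1 0 *: 'X + (C 1 1)%:P.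
  have [|z pz] := @closed_root _ p q.+1 isT.
    by rewrite !coefE eqxx !gtn_eqF // !mulr0 !addr0 mulr1.
  exists (\col_i if i == 0 then z else 1).
    by apply/eqP => /colP/(_ 1)/eqP; rewrite !mxE oner_eq0.
  apply/rowP => i; rewrite !ord1 CE !mxE /= rmorph1 !sE -[RHS]pz.
  rewrite !hornerE exprSr /=; ring.
have [w0 vw0] : exists w0, sesqui C v w0 = 1%:M.
  have /rV0Pn[j rj] : (map_mx s v)^T *m C != 0.
    apply: contraNneq v0 => /(congr1 (mulmx^~ (invmx C))).
    rewrite mulmxK // mul0mx => /(congr1 trmx)/eqP.
    by rewrite trmxK trmx0 map_mx_eq0.
  exists ((((map_mx s v)^T *m C) 0 j)^-1 *: delta_mx j 0).
  rewrite sesquiZr /sesqui -colE; apply/rowP => i; rewrite !ord1.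
  by rewrite mxE [col _ _ _ _]mxE mulVf // mxE.
(* This is the value of the form at [w0 + t *: v], simplified by [vv] and [vw0]. *)
have [t] : exists t, t ^+ q + sesqui C w0 v 0 0 * t + sesqui C w0 w0 0 0 = 0.
  pose p : {poly k} := 'X^q + sesqui C w0 v 0 0 *: 'X + (sesqui C w0 w0 0 0)%:P.
  have [|z pz] := @closed_root _ p q q0.
    by rewrite !coefE eqxx !gtn_eqF // mulr0 !addr0 oner_eq0.
  by exists z; rewrite -[RHS]pz !hornerE.
move=> t_root; pose w := w0 + t *: v.
have vw : sesqui C v w = 1%:M by rewrite sesquiDr sesquiZr vw0 vv scaler0 addr0.
have ww : sesqui C w w = 0.
  rewrite sesquiDl !sesquiDr !sesquiZl !sesquiZr vv vw0 !scaler0 addr0 sE.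
  rewrite [sesqui C w0 w0]mx11_scalar [sesqui C w0 v]mx11_scalar.
  rewrite !scale_scalar_mx -!raddfD /=.
  rewrite -[RHS](raddf0 (@scalar_mx k 1)) -t_root; congr _%:M; ring.
have uP0 : row_mx v w \in unitmx.
  apply: (@unitmx_inj k (1 + 1)) => x; rewrite -[x]vsubmxK mul_row_col => vx.
  have d0 : dsubmx x = 0.
    have := congr1 (mulmx ((map_mx s v)^T *m C)) vx.
    rewrite mulmx0 mulmxDr !mulmxA -!/(sesqui C _ _) vv vw.
    by rewrite mul0mx mul1mx add0r.
  move: vx; rewrite d0 mulmx0 addr0 [usubmx _]mx11_scalar mul_mx_scalar => /eqP.
  by rewrite scaler_eq0 (negPf v0) orbF => /eqP ->; rewrite raddf0 col_mx0.
set b := sesqui C w v 0 0.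
have wv : sesqui C w v = b%:M by rewrite [LHS]mx11_scalar.
(* Otherwise s(w)^T C would kill the basis [v], [w], forcing w = 0 against [vw]. *)
have b0 : b != 0.
  apply/eqP => b0; have : sesqui C w (row_mx v w) = 0.
    by rewrite /sesqui mul_mx_row -!/(sesqui C _ _) wv ww b0 raddf0 row_mx0.
  move/(congr1 (mulmx^~ (invmx (row_mx v w : 'M_2)))); rewrite mulmxK // mul0mx.
  move/(congr1 (mulmx^~ (invmx C))); rewrite mulmxK // mul0mx.
  move/(congr1 trmx); rewrite trmxK trmx0 => /eqP.
  rewrite map_mx_eq0 => /eqP w_0.
  move/rowP/(_ 0)/eqP: vw; rewrite w_0 /sesqui mulmx0 !mxE eq_sym.
  by rewrite oner_eq0.
have n0 : (0 < (q * q).-1)%N by rewrite -subn1 subn_gt0 (leq_mul q_gt1 q0).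
(* Scaling v by a and w by a^-q keeps the (v, w) entry equal to 1 and turns the (w, v) entry b into
   b a^(1 - q^2). *)
have [|a] := @closed_root _ ('X^((q * q).-1) - b%:P) _ n0.
  by rewrite !coefE eqxx gtn_eqF // subr0 oner_eq0.
rewrite !hornerE => /eqP; rewrite subr_eq0 => /eqP ab.
have a0 : a != 0.
  by apply: contraNneq b0 => a0; rewrite -ab a0 expr0n gtn_eqF.
pose P : 'M_(1 + 1) := row_mx (a *: v) (a ^- q *: w).
have eP : sesqui C P P = hyperbolic.
  rewrite sesqui_row !sesquiZl !sesquiZr vv vw wv ww !scaler0 !sE.
  rewrite !scale_scalar_mx mulr1 divff ?expf_neq0 //.
  rewrite exprVn -exprM -ab -exprS prednK ?muln_gt0 ?q0 //.
  by rewrite mulVf ?expf_neq0.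
exists P => //.
by have := hyperbolic_unit; rewrite -eP sesqui_unitmx uC.
Qed.

End SesquilinearForms.

(** * Frobenius forms, their matrices and smoothness *)

Lemma linear_formE (k : nzRingType) n (L : {mpoly k[n]}) : L \is 1.-homog ->
  exists c : 'I_n -> k, L = \sum_j c j *: 'X_j.
Proof.
move=> /dhomogP hL; rewrite [L]mpolyE big_seq.
elim/big_ind: _ => [|x y [c ->] [d ->]|m /hL /eqP/mdeg1P[i /eqP ->]].
- by exists (fun=> 0); rewrite big1 // => j _; rewrite scale0r.
- exists (fun j => c j + d j); rewrite -big_split /=.
  by apply: eq_bigr => j _; rewrite scalerDl.
- exists (fun j => if j == i then L@_U_(i) else 0); rewrite (bigD1 i) //= eqxx.
  by rewrite big1 ?addr0 // => j /negPf->; rewrite scale0r.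
Qed.

Section FrobeniusForms.
Variables (k : closedFieldType) (p : nat) (hp : p \in [pchar k]).

Lemma frobenius_rmorphism e :
  exists s : {rmorphism k -> k}, forall x, s x = x ^+ (p ^ e).
Proof.
elim: e => [|e [s sE]]; first by exists idfun => x; rewrite expr1.
exists (pFrobenius_aut hp \o s) => x /=.
by rewrite pFrobenius_autE sE -exprM expnSr.
Qed.

Variables (n e : nat) (F : {mpoly k[n]}).
Hypotheses (he : (1 <= e)%N) (hF : frobenius_form (p ^ e) F).

(** The q-th powers have zero derivative in characteristic p, so the gradient involves only the
    coefficients of the linear forms. *)
Lemma frobenius_matrix (s : {rmorphism k -> k}) :
    (forall x, s x = x ^+ (p ^ e)) ->
  exists A : 'M[k]_n, (forall v, mpeval F v = sesqui s A v v 0 0) /\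
    forall v i, mpeval F^`M(i) v = ((map_mx s v)^T *m A) 0 i.
Proof.
move=> sE; have [L [hL FE]] := hF.
have [c cE] : exists c : 'I_n -> 'I_n -> k,
    forall i, L i = \sum_j c i j *: 'X_j.
  have /fin_all_exists := fun i => linear_formE (hL i).
  by case=> c cE; exists c.
exists (\matrix_(i, j) c i j); split=> v => [|j].
  rewrite /sesqui -mulmxA mxE FE /mpeval raddf_sum /=; apply: eq_bigr => i _.
  rewrite !mxE mevalM rmorphXn /= mevalXU sE cE raddf_sum /=; congr (_ * _).
  by apply: eq_bigr => j _; rewrite mevalZ mevalXU mxE.
rewrite mxE FE /mpeval (raddf_sum (mderiv j)) (raddf_sum (meval _)) /=.
apply: eq_bigr => i _.
have dX : ('X_i ^+ (p ^ e))^`M(j) = 0 :> {mpoly k[n]}.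
  rewrite mpolyXn mderivX mulmnE natrM natrX (pcharf0 hp) expr0n.
  by rewrite gtn_eqF // mulr0 scale0r.
rewrite mderivM dX mul0r add0r mevalM rmorphXn /= mevalXU !mxE sE cE.
rewrite (raddf_sum (mderiv j)) (raddf_sum (meval _)) /= (bigD1 j) //=.
rewrite big1 ?addr0 => [|l /negPf lj]; rewrite mderivZ mevalZ mderivX mnm1E.
  by rewrite eqxx scale1r -[X in (X - _)%MM]add0m addmK mpolyX0 meval1 mulr1.
by rewrite lj scale0r meval0 mulr0.
Qed.

Hypothesis hsm : smooth_form F.

(** As [s] is surjective, a nonzero left kernel vector of [A] is s(v)^T for some nonzero v; both F
    and its gradient vanish at v. *)
Lemma smooth_frobenius_unit (s : {rmorphism k -> k}) (A : 'M[k]_n) :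
    (forall x, s x = x ^+ (p ^ e)) ->
    (forall v, mpeval F v = sesqui s A v v 0 0) ->
    (forall v i, mpeval F^`M(i) v = ((map_mx s v)^T *m A) 0 i) ->
  A \in unitmx.
Proof.
move=> sE FE dFE; rewrite unitmxE unitfE; apply/negP => /det0P[w w0 wA].
have s_surj y : exists x, s x = y.
  have q0 : (0 < p ^ e)%N by rewrite expn_gt0 (prime_gt0 (pcharf_prime hp)).
  have [|x xy] := @closed_root k ('X^(p ^ e) - y%:P) _ q0.
    by rewrite !coefE eqxx gtn_eqF // subr0 oner_eq0.
  by exists x; apply/eqP; rewrite sE -subr_eq0 -[X in _ == X]xy !hornerE.
have [v vw] : exists v : 'cV_n, map_mx s v = w^T.
  have [f fE] := fin_all_exists (fun i => s_surj (w 0 i)).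
  by exists (\col_i f i); apply/colP => i; rewrite !mxE fE.
have v0 : v != 0.
  by apply: contraNneq w0 => v0; rewrite -[w]trmxK -vw v0 map_mx0 trmx0.
have [|i] := hsm v0; first by rewrite FE /sesqui vw trmxK wA mul0mx mxE.
by rewrite dFE vw trmxK wA mxE eqxx.
Qed.

End FrobeniusForms.

(** * Action of PGL on lines and on the surface *)

Section ProjectiveAction.
Variables (k : fieldType) (n : nat) (F : {mpoly k[n]}).
Implicit Types (L : {vspace 'cV[k]_n}) (g : PGL k n).

Lemma PGL_act_sub g L L' : (PGL_act g L <= PGL_act g L')%VS = (L <= L')%VS.
Proof.
have actS (h : PGL k n) X Y : (X <= Y)%VS -> (PGL_act h X <= PGL_act h Y)%VS.
  exact: limgS.
apply/idP/idP => [/(actS g^-1%g)|]; last exact: actS.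
by rewrite -!PGL_actM mulVg !PGL_act1.
Qed.

Lemma skew_PGL_act g L L' :
  Defs.skew L L' -> Defs.skew (PGL_act g L) (PGL_act g L').
Proof.
rewrite /Defs.skew => LL'; apply/eqP; rewrite -subv0.
have -> : 0%VS = PGL_act g 0%VS by rewrite /PGL_act limg0.
rewrite -LL' -[X in (X <= _)%VS]PGL_act1 -(mulgV g) PGL_actM PGL_act_sub.
by rewrite subv_cap; apply/andP; split; rewrite -(PGL_act_sub g) -PGL_actM mulgV
  PGL_act1 ?capvSl ?capvSr.
Qed.

Lemma line_of_PGL_act g L :
  in_Aut F g -> line_of F L -> line_of F (PGL_act g L).
Proof.
move=> autg [dL FL]; split=> [|P ptP]; first by rewrite /is_line dim_PGL_act.
have dP : is_point (PGL_act g^-1%g P) by rewrite /is_point dim_PGL_act.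
rewrite -(PGL_act1 P) -(mulgV g) PGL_actM PGL_act_sub => /(FL _ dP).
by move/(autg _ dP).
Qed.

Lemma skew_triple_PGL_act g t :
  in_Aut F g -> skew_triple_of F t -> skew_triple_of F (triple_act g t).
Proof.
case: t => [[L1 L2] L3] autg [[l1 l2 l3] [s12 s13 s23]].
by split; split; (exact: line_of_PGL_act || exact: skew_PGL_act).
Qed.

Lemma line_of_mpeval L v : mpeval F 0 = 0 -> line_of F L -> v \in L ->
  mpeval F v = 0.
Proof.
move=> F0 [_ FL] vL; have [->//|v0] := eqVneq v 0.
have [||_ ->] := FL <[v]>%VS; rewrite ?memv_line //.
by rewrite /is_point dim_vline v0.
Qed.

Lemma PGL_mk_in_Aut (A : GL k n) :
  (forall v, mpeval F (GLmx A *m v) = mpeval F v) -> in_Aut F (PGL_mk A).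
Proof.
move=> FA P ptP; rewrite /point_of /is_point dim_PGL_act PGL_act_mk.
split=> -[_ FP]; split=> // v.
  move=> vP; rewrite -FA; apply: FP; apply/memv_imgP.
  by exists v; rewrite ?lfunE.
by case/memv_imgP => u uP ->; rewrite lfunE /= FA FP.
Qed.

End ProjectiveAction.

(** * Frames adapted to a skew triple *)

Section AdaptedFrames.
Variables (k : closedFieldType) (s : {rmorphism k -> k}) (q : nat).
Hypotheses (q_gt1 : (1 < q)%N) (sE : forall x, s x = x ^+ q).
Variables (F : {mpoly k[4]}) (A : 'M[k]_4).
Hypotheses (uA : A \in unitmx) (FE : forall v, mpeval F v = sesqui s A v v 0 0).

Lemma sesqui_line {n} (M : 'M[k]_(4, n)) :
  line_of F (colspan M) -> sesqui s A M M = 0.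
Proof.
move=> FM; apply: (sesqui_alternating q_gt1 sE) => x.
apply/rowP => i; rewrite ord1 -sesqui_mulmx -FE mxE.
apply: line_of_mpeval FM _; last by apply/memv_colspan; exists x.
by rewrite FE /sesqui mulmx0 mxE.
Qed.

(* With respect to bases of [L1] and [L2] matched by the isomorphism          *)
(* [L1 -> L2] whose graph is [L3], isotropy of the three lines leaves a       *)
(* single free invertible 2 x 2 block, which a common change of the two bases *)
(* makes hyperbolic.                                                          *)
Lemma adapted_frame L1 L2 L3 : skew_triple_of F (L1, L2, L3) ->
  exists U W : 'M[k]_(4, 2),
    [/\ row_mx U W \in unitmx, L1 = colspan U, L2 = colspan W,
        L3 = colspan (U + W) &
        sesqui s A (row_mx U W) (row_mx U W) =
        block_mx 0 (hyperbolic k) (- hyperbolic k) 0].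
Proof.
case=> -[l1 l2 l3] [s12 s13 s23].
have [M1 eM1 M1_0] := colspan_basis l1.1.
have [M2 eM2 M2_0] := colspan_basis l2.1.
have [M3 eM3 M3_0] := colspan_basis l3.1.
rewrite -eM1 -eM2 -eM3 in s12 s13 s23 l1 l2 l3 *.
have uG : row_mx M1 M2 \in unitmx by apply: (@row_mx_unit k 2 2).
pose R := invmx (row_mx M1 M2 : 'M_4) *m M3.
pose R1 : 'M_2 := usubmx (R : 'M_(2 + 2, 2)).
pose R2 : 'M_2 := dsubmx (R : 'M_(2 + 2, 2)).
have M3E : M3 = M1 *m R1 + M2 *m R2.
  by rewrite -mul_row_col vsubmxK mulKVmx.
(* A kernel vector of [R1] gives a vector of L3 lying in L2, hence zero. *)
have uR1 : R1 \in unitmx.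
  apply: unitmx_inj => x R1x; apply: M3_0; apply/eqP.
  rewrite -memv0 -[0%VS]s23 memv_cap; apply/andP; split; apply/memv_colspan.
    by exists (R2 *m x); rewrite M3E mulmxDl -!mulmxA R1x mulmx0 add0r.
  by exists x.
have uR2 : R2 \in unitmx.
  apply: unitmx_inj => x R2x; apply: M3_0; apply/eqP.
  rewrite -memv0 -[0%VS]s13 memv_cap; apply/andP; split; apply/memv_colspan.
    by exists (R1 *m x); rewrite M3E mulmxDl -!mulmxA R2x mulmx0 addr0.
  by exists x.
have uR : block_mx R1 0 0 R2 \in unitmx.
  by rewrite unitmxE det_ublock unitrM -!unitmxE uR1.
pose U := M1 *m R1; pose W := M2 *m R2.
have uUW : row_mx U W \in unitmx.
  have -> : row_mx U W = row_mx M1 M2 *m block_mx R1 0 0 R2.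
    by rewrite mul_row_block !mulmx0 addr0 add0r.
  by rewrite (@unitmx_mul k (2 + 2)) uG.
rewrite -(colspan_mulmx M1 uR1) -(colspan_mulmx M2 uR2) M3E in l1 l2 l3 *.
rewrite -/U -/W in l1 l2 l3 *; clearbody U W.
have UU := sesqui_line l1; have WW := sesqui_line l2.
have := sesqui_line l3; rewrite sesquiDl !sesquiDr UU WW add0r addr0 => /eqP.
rewrite addrC addr_eq0 => /eqP WU; set C := sesqui s A U W in WU.
have eD : sesqui s A (row_mx U W) (row_mx U W) = block_mx 0 C (- C) 0.
  by rewrite sesqui_row UU WW WU.
have uC : C \in unitmx.
  have uD : block_mx 0 C (- C) 0 \in unitmx.
    by rewrite -eD (@sesqui_unitmx _ s 4 A (row_mx U W)) uA.
  apply: unitmx_inj => x Cx.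
  have := mulKmx uD (col_mx 0 x); rewrite mul_block_col !mulmx0 mul0mx Cx.
  rewrite !addr0 col_mx0 mulmx0 => /esym/eqP.
  by rewrite col_mx_eq0 => /andP[_ /eqP].
have [P uP PP] := sesqui_hyperbolic q_gt1 sE uC.
(* Using the same [P] on both bases keeps their sum a basis of L3. *)
exists (U *m P), (W *m P); rewrite !colspan_mulmx -?mulmxDl //; split=> //.
- have -> : row_mx (U *m P) (W *m P) = row_mx U W *m block_mx P 0 0 P.
    by rewrite mul_row_block !mulmx0 addr0 add0r.
  rewrite (@unitmx_mul k (2 + 2)) uUW unitmxE det_ublock unitrM -!unitmxE.
  by rewrite uP.
- by rewrite colspan_mulmx.
- rewrite sesqui_row !sesqui_mulmx UU WW WU sesquiN PP.
  by rewrite !sesqui0.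
Qed.

End AdaptedFrames.

Theorem theorem5p1p2 (k : closedFieldType) (p : nat) (hp : p \in [pchar k])
    (e : nat) (he : (1 <= e)%N) (F : {mpoly k[4]})
    (hF : frobenius_form (p ^ e) F) (hsm : smooth_form F) :
  acts_transitively_on (@triple_act k 4) (in_Aut F) (skew_triple_of F).
Proof.
split=> [g t|]; first exact: skew_triple_PGL_act.
have [s sE] := frobenius_rmorphism hp e.
have q_gt1 : (1 < p ^ e)%N.
  by rewrite -(expn0 p) ltn_exp2l // prime_gt1 // (pcharf_prime hp).
have [A [FE dFE]] := frobenius_matrix hp he hF sE.
have uA := smooth_frobenius_unit hp hsm sE FE dFE.
move=> [[L1 L2] L3] [[L1' L2'] L3'].
move=> /(adapted_frame q_gt1 sE uA FE)[U [W [uG -> -> -> eG]]].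
move=> /(adapted_frame q_gt1 sE uA FE)[U' [W' [uG' -> -> -> eG']]].
pose G : 'M_4 := row_mx U W; pose G' : 'M_4 := row_mx U' W'.
have ug : G' *m invmx G \in unitmx by rewrite unitmx_mul unitmx_inv uG uG'.
have eA : sesqui s A (G' *m invmx G) (G' *m invmx G) = A.
  by apply: sesqui_eq; rewrite // eG eG'.
exists (PGL_mk (MkGL ug)).
  apply: PGL_mk_in_Aut => v /=.
  by rewrite !FE sesqui_mulmx eA.
(* The isometry sends U to U' and W to W', hence U + W to U' + W'. *)
have /eq_row_mx[gU gW] :
    row_mx (G' *m invmx G *m U) (G' *m invmx G *m W) = row_mx U' W'.
  by rewrite -mul_mx_row mulmxKV.
by rewrite /triple_act !PGL_act_colspan /= mulmxDr gU gW.
Qed.
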